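(* Let $N\in\mathbb{N}$, $a\ge 0$, $b>0$, and put $\alpha:=a+b-1$, $\beta:=b-1$. For $\kappa>0$ let $X_\kappa$ be an $\mathbb{R}^N$-valued random variable whose distribution $\mu_\kappa$ is the probability measure on the alcove $A:=\{x\in\mathbb{R}^N:\ -1\le x_1\le\dots\le x_N\le 1\}$ with Lebesgue density $$c_\kappa\prod_{1\le i<j\le N}(x_j-x_i)^{\kappa}\prod_{i=1}^N(1-x_i)^{\frac{\kappa(a+b)}{2}-\frac12}(1+x_i)^{\frac{\kappa b}{2}-\frac12},$$ where $c_\kappa>0$ is the normalizing constant. Let $z=(z_1,\dots,z_N)$ be the vector of the ordered zeros $z_1\le\dots\le z_N$ of the Jacobi polynomial $P_N^{(\alpha,\beta)}$; it lies in the interior of $A$. Then $X_\kappa\to z$ in probability as $\kappa\to\infty$.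
   Context: For $\alpha,\beta>-1$, $(P_n^{(\alpha,\beta)})_{n\ge0}$ denote the classical Jacobi polynomials, i.e. the orthogonal polynomials on $]-1,1[$ with respect to the weight $(1-x)^\alpha(1+x)^\beta$; $P_N^{(\alpha,\beta)}$ has degree $N$ and $N$ simple zeros in $]-1,1[$. *)

(* Defs.v *)
From HB Require Import structures.
From mathcomp Require Import all_boot all_order all_algebra.
From mathcomp Require Import all_classical all_reals all_analysis.
Set Implicit Arguments. Unset Strict Implicit. Unset Printing Implicit Defensive.
Import Order.TTheory GRing.Theory Num.Theory.
Import numFieldNormedType.Exports.
Local Open Scope classical_set_scope.
Local Open Scope ring_scope.

Definition gbinom (R : realType) (r : R) (k : nat) : R :=
  (\prod_(i < k) (r - i%:R)) / (k`!)%:R.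

Definition jacobiP (R : realType) (n : nat) (al be : R) : {poly R} :=
  \sum_(s < n.+1)
     (gbinom (n%:R + al) (n - s) * gbinom (n%:R + be) s) *:
       ((2^-1 *: ('X - 1)) ^+ s * (2^-1 *: ('X + 1)) ^+ (n - s)).

(* Iterated Lebesgue integral on R^n = 'rV[R]_n of an extended-real function;
   for nonnegative measurable integrands this is the integral w.r.t. the
   n-dimensional Lebesgue measure (Tonelli). *)
Fixpoint iint (R : realType) (n : nat) : ('rV[R]_n -> \bar R) -> \bar R :=
  match n with
  | 0 => fun f => f 0
  | n'.+1 => fun f =>
      (\int[@lebesgue_measure R]_t iint (fun v : 'rV[R]_n' => f (row_mx (\row_(i < 1) t) v)))%E
  end.

Definition alcove (R : realType) (N : nat) : set 'rV[R]_N :=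
  [set x | (forall i : 'I_N, -1 <= x ord0 i <= 1) /\
           (forall i j : 'I_N, (i <= j)%N -> x ord0 i <= x ord0 j)].

Definition jdens (R : realType) (N : nat) (a b k : R) (x : 'rV[R]_N) : R :=
  (\prod_(i < N) \prod_(j < N | (i < j)%N) (x ord0 j - x ord0 i) `^ k) *
  \prod_(i < N) ((1 - x ord0 i) `^ (k * (a + b) / 2 - 2^-1) *
                 (1 + x ord0 i) `^ (k * b / 2 - 2^-1)).

Definition jmu (R : realType) (N : nat) (a b k : R) (S : set 'rV[R]_N) : R :=
  fine (iint (fun x => (\1_(@alcove R N `&` S) x * jdens a b k x)%:E)) /
  fine (iint (fun x => (\1_(@alcove R N) x * jdens a b k x)%:E)).

Arguments alcove {R} N _.
Arguments jmu {R} N a b k S.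

(* Main.v *)
Require Import Defs.
From HB Require Import structures.
From mathcomp Require Import all_boot all_order all_algebra.
From mathcomp Require Import all_classical all_reals all_analysis.
From mathcomp Require Import measurable_realfun ring lra.
Import Order.TTheory GRing.Theory Num.Theory.
Import numFieldNormedType.Exports.
Local Open Scope classical_set_scope.
Local Open Scope ring_scope.

(** Writing [p = (a + b) / 2] and [q = b / 2], the density is, up to fixed
    powers, the [k]-th power of
    [prod_(i<j) (x_j - x_i) prod_i (1 - x_i)^p (1 + x_i)^q].
    The Jacobi differential equation at the zeros says that [z] is a critical
    point of its logarithm.  Applying [t <= exp (t - 1)] to every factor divided
    by its value at [z], the exponents add up to a linear form in [x - z] whose
    coefficients are these critical equations, hence to zero: [z] is the global
    maximum.  The sharper [t <= exp (t - 1 - (sqrt t - 1)^2)] for the factors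
    [(1 + x_i) / (1 + z_i)] makes the density exponentially small in [k],
    relative to its value at [z], as soon as [x] is at distance [eps] from [z].
    On a small cube around [z] the decay is at most half that rate, so the cube
    alone makes the normalizing integral large enough. *)

(** * The Jacobi differential equation and the location of the zeros *)

Section Jacobi.
Variables (R : realType) (n : nat) (al be : R).

Let u : {poly R} := 2^-1 *: ('X - 1).
Let v : {poly R} := 2^-1 *: ('X + 1).
Let c (s : nat) : R := gbinom (n%:R + al) (n - s) * gbinom (n%:R + be) s.

Lemma gbinomS (r : R) k :
  gbinom r k.+1 * k.+1%:R = gbinom r k * (r - k%:R).
Proof.
rewrite /gbinom big_ord_recr /= factS natrM.
have h1 : (k.+1%:R : R) != 0 by rewrite pnatr_eq0.
have h2 : (k`!%:R : R) != 0 by rewrite pnatr_eq0 -lt0n fact_gt0.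
field; apply/andP; split=> //; rewrite addrC natr1.
Qed.

Lemma gbinom_gt0 (r : R) k : (k%:R - 1 < r) -> 0 < gbinom r k.
Proof.
move=> h; apply: divr_gt0; last by rewrite ltr0n fact_gt0.
apply: prodr_gt0 => i _.
have : (i.+1%:R : R) <= k%:R by rewrite ler_nat ltn_ord.
rewrite -natr1; lra.
Qed.

Lemma jacobi_coef_gt0 s : -1 < al -> -1 < be -> (s <= n)%N -> 0 < c s.
Proof.
move=> ha hb hs; have hs' : (s%:R : R) <= n%:R by rewrite ler_nat.
have hs0 : (0 : R) <= s%:R by [].
by apply: mulr_gt0; apply: gbinom_gt0; rewrite ?natrB //; lra.
Qed.

(** This two-term recursion matches what the Jacobi operator raises from the monomial [s] with what
    it lowers from the monomial [s.+1]; the telescoping in [jacobi_op] rests on it. *)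
Lemma jacobi_coefS s : (s < n)%N ->
  c s.+1 * (s.+1%:R * (s.+1%:R + al)) =
  c s * ((n - s)%:R * ((n - s)%:R + be)).
Proof.
move=> hs; rewrite /c.
have -> : (n - s = (n - s.+1).+1)%N by rewrite subnSK.
have e1 := gbinomS (n%:R + al) (n - s.+1).
have e2 := gbinomS (n%:R + be) s.
have e3 : (n - s.+1)%:R = n%:R - s.+1%:R :> R by rewrite natrB.
have e4 : n%:R + al - (n - s.+1)%:R = s.+1%:R + al by rewrite e3; ring.
have e5 : (n - s.+1).+1%:R + be = n%:R + be - s%:R.
  by rewrite -natr1 e3 -natr1; ring.
rewrite e5; rewrite e4 in e1.
transitivity ((gbinom (n%:R + be) s.+1 * s.+1%:R)
  * (gbinom (n%:R + al) (n - s.+1) * (s.+1%:R + al))); first by ring.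
by rewrite e2 -e1; ring.
Qed.

Lemma deriv_u : u^`() = (2^-1)%:P.
Proof. by rewrite /u derivZ derivB derivX derivC subr0 alg_polyC. Qed.

Lemma deriv_v : v^`() = (2^-1)%:P.
Proof. by rewrite /v derivZ derivD derivX derivC addr0 alg_polyC. Qed.

(** Multiplying the derivative back by [w] keeps the exponent at [s], so no predecessor exponent has
    to be treated later. *)
Lemma euler_exp (w : {poly R}) s : w^`() = (2^-1)%:P ->
  w * (w ^+ s)^`() = (s%:R / 2)%:P * w ^+ s.
Proof.
case: s => [|s] hw; first by rewrite expr0 derivC mulr0 mul0r mul0r.
rewrite deriv_exp /= hw exprS polyCM -(mulr_natl (_ * _)) -polyC_natr; ring.
Qed.

Lemma euler_exp2 (w : {poly R}) s : w^`() = (2^-1)%:P ->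
  w * (w ^+ s)^`()^`() = ((s%:R - 1) / 2)%:P * (w ^+ s)^`().
Proof.
move=> hw; have := congr1 (@deriv R) (euler_exp w s hw).
rewrite !derivM hw derivC mul0r add0r => /(canRL (addKr _)) ->.
rewrite !(polyCM, polyCB); ring.
Qed.

Let m (s : nat) := u ^+ s * v ^+ (n - s).
Let lam : R := n%:R * (n%:R + al + be + 1).
Let w (s : nat) : R := c s * (s%:R * (s%:R + al)).
Let g (s : nat) : {poly R} := w s *: (m s - u ^+ s.-1 * v ^+ (n - s.-1)).

(* The Jacobi operator up to sign, with [1 - 'X^2 = - 4 u v] and
   [be - al - (al + be + 2) 'X = - 2 ((al + 1) v + (be + 1) u)]. *)
Let L (p : {poly R}) : {poly R} :=
  4%:P * (u * v * p^`()^`()) +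
  2%:P * (((al + 1)%:P * v + (be + 1)%:P * u) * p^`()).

(** Each derivative lowers the degree in [u], [v] by one and its coefficient restores it, so [L]
    maps [m s] to a combination of itself and its two neighbours. The middle coefficient is written
    so that the three visibly add up to [lam]. *)
Lemma jacobi_op_monomial s : (s <= n)%N ->
  L (m s) = (s%:R * (s%:R + al))%:P * (u ^+ s.-1 * v ^+ (n - s.-1))
    + (lam - (n - s)%:R * ((n - s)%:R + be) - s%:R * (s%:R + al))%:P * m s
    + ((n - s)%:R * ((n - s)%:R + be))%:P * (u ^+ s.+1 * v ^+ (n - s.+1)).
Proof.
move=> hs; rewrite /L /m /lam.
have e1 := euler_exp u s deriv_u; have e2 := euler_exp2 u s deriv_u.
have f1 := euler_exp v (n - s) deriv_v; have f2 := euler_exp2 v (n - s) deriv_v.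
(* [k1] and [k2] trade the truncated exponents [s.-1] and [n - s.+1] for derivatives; where
   truncation bites, the factor [s] or [n - s] is zero. *)
have k1 : (s%:R)%:P * (u ^+ s.-1 * v ^+ (n - s.-1)) =
          2%:P * (u ^+ s)^`() * (v * v ^+ (n - s)).
  case: s hs {e1 e2 f1 f2} => [|s] hs.
    by rewrite expr0 derivC mul0r mulr0 mul0r.
  rewrite /= deriv_exp /= deriv_u -exprS subnSK //.
  have -> : (2^-1)%:P * u ^+ s *+ s.+1 = (2^-1)%:P * (s.+1%:R)%:P * u ^+ s.
    by rewrite -mulr_natl -polyC_natr; ring.
  have t : (2%:P * (2^-1)%:P : {poly R}) = 1 by rewrite -polyCM divff.
  by rewrite !mulrA t; ring.
have k2 : ((n - s)%:R)%:P * (u ^+ s.+1 * v ^+ (n - s.+1)) =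
          2%:P * (v ^+ (n - s))^`() * (u * u ^+ s).
  rewrite subnS; case: (n - s)%N {e1 e2 f1 f2 k1} => [|k].
    by rewrite expr0 derivC mul0r mulr0 mul0r.
  rewrite /= deriv_exp /= deriv_v -exprS.
  have -> : (2^-1)%:P * v ^+ k *+ k.+1 = (2^-1)%:P * (k.+1%:R)%:P * v ^+ k.
    by rewrite -mulr_natl -polyC_natr; ring.
  have t : (2%:P * (2^-1)%:P : {poly R}) = 1 by rewrite -polyCM divff.
  by rewrite !mulrA t; ring.
have hn : n%:R = (n - s)%:R + s%:R :> R by rewrite natrB //; ring.
rewrite hn.
set r := (n - s)%:R in hn e1 e2 f1 f2 k1 k2 *.
set A := u ^+ s in e1 e2 k1 k2 *; set B := v ^+ (n - s) in f1 f2 k1 k2 *.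
rewrite (polyCM s%:R) (polyCM r).
rewrite [X in _ = X + _ + _](_ : _ =
  (s%:R + al)%:P * (2%:P * A^`() * (v * B))); last by rewrite -k1; ring.
rewrite [X in _ = _ + X](_ : _ =
  (r + be)%:P * (2%:P * B^`() * (u * A))); last by rewrite -k2; ring.
rewrite !(derivM, derivD).
have E : u * v * (A^`()^`() * B + A^`() * B^`() + (A^`() * B^`() + A * B^`()^`()))
 = (u * A^`()^`()) * (v * B) + 2 * (u * A^`()) * (v * B^`()) + (v * B^`()^`()) * (u * A).
  by ring.
rewrite E e2 e1 f2 f1.
have E2 : ((al + 1)%:P * v + (be + 1)%:P * u) * (A^`() * B + A * B^`())
  = (al + 1)%:P * A^`() * (v * B) + (be + 1)%:P * B^`() * (u * A)
    + (al + 1)%:P * A * (v * B^`()) + (be + 1)%:P * B * (u * A^`()) by ring.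
rewrite E2 e1 f1.
have h4 : 4%:P = 2%:P * 2%:P :> {poly R} by rewrite -polyCM; congr (_%:P); ring.
have t : (2%:P * (2^-1)%:P : {poly R}) = 1 by rewrite -polyCM divff.
rewrite h4.
have two : 2 = 2%:P :> {poly R} by rewrite polyC_natr.
rewrite two !(polyCM, polyCB, polyCD).
set i2 := (2^-1)%:P in t *; clear - t.
(* Each [i2] is paired with a [2%:P]; once the pairs are replaced by [1], no inverse is left and the
   identity is a pure ring identity. *)
transitivity ((s%:R%:P - 1) * A^`() * (v * B) * 2%:P * (2%:P * i2)
  + 2%:P * s%:R%:P * A * r%:P * B * (2%:P * i2) * (2%:P * i2)
  + (r%:P - 1) * B^`() * (u * A) * 2%:P * (2%:P * i2)
  + 2%:P * (al%:P + 1) * A^`() * (v * B) + 2%:P * (be%:P + 1) * B^`() * (u * A)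
  + (al%:P + 1) * A * r%:P * B * (2%:P * i2)
  + (be%:P + 1) * B * s%:R%:P * A * (2%:P * i2)); first by ring.
rewrite t (_ : 2%:P = 1 + 1); first by ring.
by rewrite -polyC1 -polyCD.
Qed.

(* [c s *: L (m s) - lam *: (c s *: m s) = g s.+1 - g s], and the sum telescopes. *)
Lemma jacobi_op : L (jacobiP n al be) = lam *: jacobiP n al be.
Proof.
have Lsum : forall (F : nat -> {poly R}) k,
    L (\sum_(s < k) F s) = \sum_(s < k) L (F s).
  by move=> F k; rewrite /L !linear_sum /= !mulr_sumr -big_split.
have LZ : forall a p, L (a *: p) = a *: L p.
  by move=> a p; rewrite /L !derivZ -!mul_polyC; ring.
have -> : jacobiP n al be = \sum_(s < n.+1) (c s *: m s) by [].
rewrite (Lsum (fun s => c s *: m s)) scaler_sumr.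
apply/eqP; rewrite -subr_eq0 -sumrB.
have tel : forall s, (s < n.+1)%N ->
   L (c s *: m s) - lam *: (c s *: m s) = (if s == n then 0 else g s.+1) - g s.
  move=> s hs; rewrite LZ jacobi_op_monomial //.
  (* At [s = n] the raising coefficient vanishes, whence the [0] in place of [g s.+1]; at the other
     end [w 0 = 0] gives [g 0 = 0]. *)
  case: eqP => [->|/eqP sn].
    rewrite /g /w subnn !(mul0r, subr0, polyC0, addr0) -!mul_polyC.
    rewrite !(polyCM, polyCB, polyCD); ring.
  have hsn : (s < n)%N by rewrite ltn_neqAle sn.
  rewrite /g {1}/w jacobi_coefS // /= /w -!mul_polyC /m.
  rewrite !(polyCM, polyCB, polyCD); ring.
rewrite (eq_bigr (fun s : 'I_n.+1 => (if s == n :> nat then 0 else g s.+1) - g s)); last first.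
  by move=> s _; rewrite tel.
rewrite sumrB big_ord_recr /= eqxx addr0 big_ord_recl /=.
rewrite {2}/g /w mul0r mulr0 scale0r add0r subr_eq0; apply/eqP.
by apply: eq_bigr => i _; rewrite ltn_eqF.
Qed.

Lemma jacobi_ode :
  (1 - 'X ^+ 2) * (jacobiP n al be)^`()^`()
  + ((be - al)%:P - (al + be + 2)%:P * 'X) * (jacobiP n al be)^`()
  + lam *: jacobiP n al be = 0.
Proof.
rewrite -jacobi_op /L; set p := jacobiP _ _ _.
have hu : 2%:P * u = 'X - 1 by rewrite /u mul_polyC scalerA divff // scale1r.
have hv : 2%:P * v = 'X + 1 by rewrite /v mul_polyC scalerA divff // scale1r.
have -> : 4%:P * (u * v * p^`()^`()) = ('X - 1) * ('X + 1) * p^`()^`().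
  rewrite -hu -hv (_ : 4 = 2 * 2 :> R); last by ring.
  by rewrite polyCM; ring.
have -> : 2%:P * (((al + 1)%:P * v + (be + 1)%:P * u) * p^`()) =
  ((al + 1)%:P * ('X + 1) + (be + 1)%:P * ('X - 1)) * p^`().
  by rewrite -hu -hv; ring.
by rewrite !(polyCM, polyCB, polyCD); ring.
Qed.

Lemma jacobiP_hornerE x : (jacobiP n al be).[x] =
  \sum_(s < n.+1) c s * (((x - 1) / 2) ^+ s * ((x + 1) / 2) ^+ (n - s)).
Proof.
rewrite /jacobiP horner_sum; apply: eq_bigr => s _.
have hu : u.[x] = (x - 1) / 2 by rewrite !hornerE mulrC.
have hv : v.[x] = (x + 1) / 2 by rewrite !hornerE mulrC.
by rewrite hornerZ hornerM !horner_exp hu hv.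
Qed.

(** Outside the open interval the terms of [jacobiP_hornerE] cannot cancel. For [x >= 1] all are
    nonnegative and the one at [s = 0] is positive; for [x <= -1] the same holds after
    multiplication by [(-1) ^+ n], with [s = n] positive. *)
Lemma jacobiP_root_itv x : -1 < al -> -1 < be ->
  root (jacobiP n al be) x -> -1 < x < 1.
Proof.
move=> ha hb; rewrite /root jacobiP_hornerE => /eqP h0.
apply/andP; split; rewrite ltNge; apply/negP => hx.
- have : 0 < (-1) ^+ n * \sum_(s < n.+1)
     c s * (((x - 1) / 2) ^+ s * ((x + 1) / 2) ^+ (n - s)).
    rewrite mulr_sumr (eq_bigr (fun s : 'I_n.+1 =>
      c s * (((1 - x) / 2) ^+ s * ((- 1 - x) / 2) ^+ (n - s)))); last first.
      move=> s _; have hs : (s <= n)%N by rewrite -ltnS.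
      rewrite -{1}(subnKC hs) exprD.
      rewrite (_ : (1 - x) / 2 = -1 * ((x - 1) / 2)); last by field.
      rewrite (_ : (-1 - x) / 2 = -1 * ((x + 1) / 2)); last by field.
      move: ((x - 1) / 2) ((x + 1) / 2) => U V; rewrite !exprMn; ring.
    rewrite big_ord_recr /= subnn expr0 mulr1 ltr_wpDl //.
      apply: sumr_ge0 => i _; apply: mulr_ge0.
        by apply/ltW/jacobi_coef_gt0 => //; apply: ltnW.
      by apply: mulr_ge0; apply: exprn_ge0; lra.
    apply: mulr_gt0; first exact: jacobi_coef_gt0.
    by apply: exprn_gt0; lra.
  by rewrite h0 mulr0 ltxx.
- have : 0 < \sum_(s < n.+1)
     c s * (((x - 1) / 2) ^+ s * ((x + 1) / 2) ^+ (n - s)).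
    rewrite big_ord_recl ltr_pwDl //.
      rewrite /= expr0 mul1r subn0; apply: mulr_gt0; first exact: jacobi_coef_gt0.
      by apply: exprn_gt0; lra.
    apply: sumr_ge0 => i _; apply: mulr_ge0.
      by apply/ltW/jacobi_coef_gt0 => //; exact: ltn_ord.
    by apply: mulr_ge0; apply: exprn_ge0; lra.
  by rewrite h0 ltxx.
Qed.

Lemma size_jacobiP : (size (jacobiP n al be) <= n.+1)%N.
Proof.
apply: (leq_trans (size_sum _ _ _)); apply/bigmax_leqP => s _.
apply: (leq_trans (size_scale_leq _ _)).
have hw : forall (q : {poly R}) k, (size q <= 2)%N -> (size (q ^+ k) <= k.+1)%N.
  move=> q k hq; apply: (leq_trans (size_exp_leq _ _)).
  by rewrite ltnS -[leqRHS]mul1n leq_mul2r; apply/orP; right; case: (size q) hq.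
apply: (leq_trans (size_mul_leq _ _)).
have h1 : (size (u ^+ s) <= s.+1)%N.
  apply: hw; apply: (leq_trans (size_scale_leq _ _)).
  by rewrite -polyC1 size_XsubC.
have h2 : (size (v ^+ (n - s)) <= (n - s).+1)%N.
  apply: hw; apply: (leq_trans (size_scale_leq _ _)).
  by rewrite -polyC1 size_XaddC.
have hs : (s <= n)%N by rewrite -ltnS.
apply: (@leq_trans (s.+1 + (n - s).+1).-1); last by rewrite addSn addnS /= subnKC.
by rewrite -!subn1 leq_sub2r // leq_add.
Qed.
End Jacobi.

(** * The critical equations satisfied by the zeros *)

Lemma logderiv_prod_XsubC (R : realType) (r : seq R) (x : R) : x \notin r ->
  (\prod_(y <- r) ('X - y%:P))^`().[x] =
  (\prod_(y <- r) ('X - y%:P)).[x] * \sum_(y <- r) (x - y)^-1.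
Proof.
elim: r => [|y r ih]; first by rewrite !big_nil derivC !hornerE.
rewrite inE negb_or => /andP[xy xr].
rewrite !big_cons derivM derivXsubC mul1r !hornerE ih //.
have h : x - y != 0 by rewrite subr_eq0.
by rewrite mulrDr [in RHS]mulrAC divff // mul1r; ring.
Qed.

(** Stieltjes' relations. Writing [p] as a multiple of [('X - z i) q], the quotient [p'' / p'] at
    [z i] is twice the logarithmic derivative of [q]; the differential equation at [z i], divided by
    [1 - z i ^+ 2], is the claim in partial fractions. *)
Lemma jacobi_critical (R : realType) (N : nat) (al be : R) (z : 'I_N -> R) :
  -1 < al -> -1 < be -> injective z ->
  (forall i, root (jacobiP N al be) (z i)) ->
  forall i, 2 * (\sum_(j < N | j != i) (z i - z j)^-1)
    - (al + 1) / (1 - z i) + (be + 1) / (1 + z i) = 0.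
Proof.
move=> ha hb zinj zroot i.
set p := jacobiP N al be.
have p0 : p != 0.
  apply/eqP => p0; have : root p 1 by rewrite p0 root0.
  by move=> /(jacobiP_root_itv _ _ _ _ _ ha hb); rewrite ltxx andbF.
set rs := [seq z j | j <- enum 'I_N].
have urs : uniq rs by rewrite map_inj_uniq ?enum_uniq.
have szrs : size rs = N by rewrite size_map size_enum_ord.
have rrs : all (root p) rs by apply/allP => _ /mapP[j _ ->].
(* The [N] distinct roots bound the degree from below, so the leading coefficient need not be
   computed. *)
have szp : size p = (size rs).+1.
  apply/eqP; rewrite eqn_leq szrs size_jacobiP /=.
  by rewrite -{1}szrs max_poly_roots.
have pE : p = lead_coef p *: \prod_(j < N) ('X - (z j)%:P).
  rewrite {1}(all_roots_prod_XsubC szp rrs) ?uniq_rootsE //.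
  by rewrite big_map big_enum.
set rs' := [seq z j | j <- index_enum 'I_N & j != i].
set q := \prod_(y <- rs') ('X - y%:P).
have qE : p = lead_coef p *: (('X - (z i)%:P) * q).
  by rewrite {1}pE (bigD1 i) //= /q big_map big_filter.
have zi' : z i \notin rs'.
  apply/mapP => -[j]; rewrite mem_filter => /andP[ji _] /zinj ij.
  by rewrite ij eqxx in ji.
have qz : q.[z i] != 0.
  by rewrite -[_ == _]/(root q (z i)) root_prod_XsubC.
have lp : lead_coef p != 0 by rewrite lead_coef_eq0.
have d1 : p^`().[z i] = lead_coef p * q.[z i].
  by rewrite {1}qE derivZ derivM derivXsubC !hornerE subrr mul0r addr0.
have d2 : p^`()^`().[z i] = lead_coef p * (2 * q^`().[z i]).
  rewrite {1}qE derivZ derivM derivXsubC mul1r derivZ derivD derivM derivXsubC mul1r.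
  by rewrite hornerZ !hornerD hornerM hornerXsubC subrr; ring.
have q1 : q^`().[z i] = q.[z i] * \sum_(j < N | j != i) (z i - z j)^-1.
  rewrite /q logderiv_prod_XsubC //; congr (_ * _).
  by rewrite big_map big_filter.
have /andP[z1 z2] := jacobiP_root_itv _ _ _ _ _ ha hb (zroot i).
have := congr1 (fun p => p.[z i]) (jacobi_ode _ N al be).
rewrite -/p !hornerE (rootP (zroot i)) mulr0 addr0 d1 d2 q1.
set S := \sum_(j < N | _) _ => /= h.
have e : lead_coef p * q.[z i] * ((1 - z i ^+ 2) * (2 * S)
          + (be - al - (al + be + 2) * z i)) = 0 by rewrite -h; ring.
move/eqP: e; rewrite !mulf_eq0 (negbTE lp) (negbTE qz) /= => /eqP e.
have n1 : 1 - z i != 0 by rewrite subr_eq0 gt_eqF.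
have n2 : 1 + z i != 0 by rewrite addrC gt_eqF //; lra.
apply: (mulfI (mulf_neq0 n1 n2)); rewrite mulr0 -e; field.
by rewrite n1 n2.
Qed.


(** * Monotonicity of the iterated integral and volumes of boxes *)

Section IteratedIntegral.
Variable R : realType.
Local Open Scope ereal_scope.
Local Notation mu := (@lebesgue_measure R).

(* No measurability is assumed: the integral of a nonnegative function is a
   supremum over the simple functions below it. *)
Lemma le_ge0_integral (f g : R -> \bar R) : (forall x, 0 <= f x) ->
  (forall x, f x <= g x) -> \int[mu]_x f x <= \int[mu]_x g x.
Proof.
move=> f0 fg; have g0 x : 0 <= g x by exact: le_trans (f0 x) (fg x).
rewrite !ge0_integralTE //.
apply: ge_ereal_sup => _ [h hf <-]; apply: ereal_sup_ubound.
by exists h => // x; apply: le_trans (hf x) (fg x).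
Qed.

Lemma iint_ge0 n (f : 'rV[R]_n -> \bar R) : (forall x, 0 <= f x) -> 0 <= iint f.
Proof.
elim: n f => [|n ih] f f0 /=; first exact: f0.
by apply: integral_ge0 => t _; apply: ih => v.
Qed.

Lemma le_iint n (f g : 'rV[R]_n -> \bar R) : (forall x, 0 <= f x) ->
  (forall x, f x <= g x) -> iint f <= iint g.
Proof.
elim: n f g => [|n ih] f g f0 fg /=; first exact: fg.
apply: le_ge0_integral => t; first by apply: iint_ge0.
by apply: ih => v.
Qed.

(** The constant [C] serves the induction: with the first coordinate fixed, its indicator is
    absorbed into the constant. *)
Lemma iint_box n (l r : 'I_n -> R) (C : R) : (0 <= C)%R ->
  (forall i, (l i <= r i)%R) ->
  iint (fun x : 'rV[R]_n => (C * \prod_i \1_`[l i, r i] (x ord0 i))%:E) =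
  (C * \prod_i (r i - l i))%:E.
Proof.
elim: n l r C => [|n ih] l r C C0 lr /=; first by rewrite !big_ord0.
pose P := (\prod_(i < n) (r (lift ord0 i) - l (lift ord0 i)))%R.
transitivity (\int[mu]_t ((C * P)%:E * (\1_`[l ord0, r ord0] t)%:E)).
  apply: eq_integral => t _.
  rewrite -EFinM mulrAC.
  rewrite -(ih (fun i => l (lift ord0 i)) (fun i => r (lift ord0 i))) //; last first.
    by rewrite mulr_ge0.
  congr iint; apply/funext => v; congr (_%:E).
  rewrite big_ord_recl mulrA.
  have e0 : row_mx (\row_(i < 1) t) v ord0 ord0 = t.
    rewrite (_ : ord0 = lshift n (ord0 : 'I_1)) ?row_mxEl ?mxE //.
    exact/val_inj.
  rewrite [X in \1__ X]e0; congr (_ * _)%R; apply: eq_bigr => i _.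
  congr (\1__ _).
  have -> : lift ord0 i = rshift 1 i by apply: val_inj.
  by rewrite [LHS]row_mxEr.
rewrite ge0_integralZl//; last 2 first.
- by apply/measurable_EFinP; exact: measurable_indic.
- by rewrite lee_fin mulr_ge0 // prodr_ge0 // => i _; rewrite subr_ge0.
rewrite integral_indic // setIT /= lebesgue_measure_itv /= lte_fin.
rewrite big_ord_recl -/P; case: ltP => h.
  by rewrite -EFinD -EFinM; congr (_%:E); ring.
have -> : r ord0 = l ord0 by apply/eqP; rewrite eq_le h lr.
by rewrite mule0 subrr mul0r mulr0.
Qed.
End IteratedIntegral.


(** * Exponential bounds for powers *)

Section PowerBounds.
Variable R : realType.
Implicit Types y w k s t : R.

Lemma powR_le_scale y w k s : 0 <= y -> 0 < w -> 0 <= k ->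
  y <= w * expR s -> y `^ k <= w `^ k * expR (k * s).
Proof.
move=> y0 w0 k0 h; rewrite (mulrC k) expRM -powRM ?expR_ge0 ?(ltW w0) //.
by apply: (ge0_ler_powR k0); rewrite ?nnegrE ?mulr_ge0 ?expR_ge0 ?(ltW w0).
Qed.

Lemma powR_ge_scale y w k s : 0 < w -> 0 <= k ->
  w * expR s <= y -> w `^ k * expR (k * s) <= y `^ k.
Proof.
move=> w0 k0 h; rewrite (mulrC k) expRM -powRM ?expR_ge0 ?(ltW w0) //.
have wp : 0 <= w * expR s by rewrite mulr_ge0 ?expR_ge0 // ltW.
by apply: ge0_ler_powR; rewrite ?nnegrE // (le_trans wp).
Qed.

Lemma le_expR_subr1 t : t <= expR (t - 1).
Proof. by have := expR_ge1Dx (t - 1); rewrite addrC subrK. Qed.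

(* [ln t = 2 ln (sqrt t) <= 2 (sqrt t - 1)]; the square is the loss with
   respect to the tangent bound. *)
Lemma le_expR_tangent_gap t : 0 <= t ->
  t <= expR (t - 1 - (Num.sqrt t - 1) ^+ 2).
Proof.
move=> t0; set s := Num.sqrt t; have st : s ^+ 2 = t by rewrite sqr_sqrtr.
have -> : t - 1 - (s - 1) ^+ 2 = (s - 1) + (s - 1) by rewrite -st; ring.
rewrite expRD -st expr2; apply: ler_pM; rewrite ?sqrtr_ge0 //;
  exact: le_expR_subr1.
Qed.

Lemma powR_le_tangent y w k : 0 <= y -> 0 < w -> 0 <= k ->
  y `^ k <= w `^ k * expR (k * (y / w - 1)).
Proof.
move=> y0 w0 k0; apply: powR_le_scale => //.
by rewrite mulrC -ler_pdivrMr // le_expR_subr1.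
Qed.

Lemma powR_le_tangent_gap y w k : 0 <= y -> 0 < w -> 0 <= k ->
  y `^ k <= w `^ k * expR (k * (y / w - 1 - (Num.sqrt (y / w) - 1) ^+ 2)).
Proof.
move=> y0 w0 k0; apply: powR_le_scale => //.
by rewrite mulrC -ler_pdivrMr // le_expR_tangent_gap // divr_ge0 // ltW.
Qed.

Lemma exists_pos_lbound (I : finType) (P : pred I) (f : I -> R) :
  (forall i, P i -> 0 < f i) ->
  exists2 m, 0 < m & forall i, P i -> m <= f i.
Proof.
move=> f0; exists (\big[Order.min/1]_(i | P i) f i).
  by apply/lt_bigmin.
by move=> i Pi; apply: bigmin_le_cond.
Qed.

(** With [s] the square root of [t], [t - 1 = (s - 1) * (s + 1)] and [s + 1 <= t + 2 <= D], so [s]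
    inherits the deviation of [t] from [1] up to the factor [D]. *)
Lemma sqrt_gap t e D : 0 < e -> 0 < D -> 0 <= t -> t + 2 <= D ->
  e <= `|t - 1| -> (e / D) ^+ 2 <= (Num.sqrt t - 1) ^+ 2.
Proof.
move=> e0 D0 t0 tD et; set s := Num.sqrt t.
have st : s ^+ 2 = t by rewrite sqr_sqrtr.
have s0 : 0 <= s by rewrite sqrtr_ge0.
rewrite -(real_normK (num_real (s - 1))) lerXn2r ?nnegrE ?divr_ge0 ?(ltW e0) ?(ltW D0) //.
rewrite ler_pdivrMr //; apply: (le_trans et).
have -> : t - 1 = (s - 1) * (s + 1) by rewrite -st; ring.
rewrite normrM ler_wpM2l // ger0_norm; last by lra.
have := sqr_ge0 (s - 1); rewrite -st in tD.
have -> : (s - 1) ^+ 2 = s ^+ 2 - 2 * s + 1 by ring.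
lra.
Qed.
End PowerBounds.

(** * Upper and lower bounds for the density relative to its value at [z] *)

Section Density.
Variables (R : realType) (N : nat) (a b : R) (z : 'rV[R]_N).
Hypotheses (a0 : 0 <= a) (b0 : 0 < b).
Hypothesis z_incr : forall i j : 'I_N, (i < j)%N -> z ord0 i < z ord0 j.
Hypothesis z_itv : forall i : 'I_N, -1 < z ord0 i < 1.
Hypothesis z_crit : forall i : 'I_N,
  2 * (\sum_(j < N | j != i) (z ord0 i - z ord0 j)^-1)
    - (a + b) / (1 - z ord0 i) + b / (1 + z ord0 i) = 0.

Implicit Types (x : 'rV[R]_N) (k : R).

(** The loss in the sharpened tangent bound for the factor [1 + x_i]. These factors alone detect
    every coordinate. *)
Let gap x (i : 'I_N) : R :=
  (Num.sqrt ((1 + x ord0 i) / (1 + z ord0 i)) - 1) ^+ 2.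

(** Each pair [i < j] contributes to the coefficients of both [h i] and [h j]; exchanging the sums
    in the half with [j < i] puts all terms over [i < j]. *)
Lemma sum_pairs_antisym (h v : 'I_N -> R) :
  \sum_(i < N) \sum_(j < N | (i < j)%N) (h j - h i) / (v j - v i) =
  \sum_(i < N) h i * \sum_(j < N | j != i) (v i - v j)^-1.
Proof.
have hs (i : 'I_N) : \sum_(j < N | j != i) (v i - v j)^-1 =
    \sum_(j < N | (i < j)%N) (v i - v j)^-1 +
    \sum_(j < N | (j < i)%N) (v i - v j)^-1.
  rewrite (bigID (fun j : 'I_N => (i < j)%N)) /=; congr (_ + _).
    apply: eq_bigl => j; rewrite -val_eqE /=.
    by case: ltngtP.
  by apply: eq_bigl => j; rewrite -val_eqE /=; case: ltngtP.
under [RHS]eq_bigr => i _ do rewrite hs mulrDr !mulr_sumr.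
rewrite big_split /= [X in _ = _ + X](exchange_big_dep xpredT) //= -big_split /=.
apply: eq_bigr => i _; rewrite -big_split /=; apply: eq_bigr => j _.
by rewrite mulrBl addrC -mulrN -invrN opprB.
Qed.

(** The expression is linear in [h = x - z]. Collected by [sum_pairs_antisym], the coefficient of
    [h i] is half the left side of [z_crit]. *)
Lemma critical_sum x :
  \sum_(i < N) \sum_(j < N | (i < j)%N)
     ((x ord0 j - x ord0 i) / (z ord0 j - z ord0 i) - 1)
  + \sum_(i < N) ((a + b) / 2 * ((1 - x ord0 i) / (1 - z ord0 i) - 1)
                   + b / 2 * ((1 + x ord0 i) / (1 + z ord0 i) - 1)) = 0.
Proof.
pose h i := x ord0 i - z ord0 i.
rewrite (eq_bigr (fun i : 'I_N => \sum_(j < N | (i < j)%N)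
    (h j - h i) / (z ord0 j - z ord0 i))); last first.
  move=> i _; apply: eq_bigr => j /z_incr ij.
  have n0 : z ord0 j - z ord0 i != 0 by rewrite subr_eq0 gt_eqF.
  by rewrite /h; field.
rewrite sum_pairs_antisym -big_split /= big1 // => i _.
have /andP[z1 z2] := z_itv i.
have n1 : 1 - z ord0 i != 0 by rewrite subr_eq0 gt_eqF.
have n2 : 1 + z ord0 i != 0 by rewrite addrC gt_eqF //; lra.
have := z_crit i; set S := \sum_(j < N | _) _ => hc.
transitivity (h i / 2 * (2 * S - (a + b) / (1 - z ord0 i) + b / (1 + z ord0 i))).
  by rewrite /h; field; rewrite n1 n2.
by rewrite hc mulr0.
Qed.

Lemma jdens_gt0 k : 0 < jdens a b k z.
Proof.
apply: mulr_gt0; apply: prodr_gt0 => i _.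
  by apply: prodr_gt0 => j ij; rewrite powR_gt0 // subr_gt0 z_incr.
have /andP[z1 z2] := z_itv i.
by apply: mulr_gt0; apply: powR_gt0; lra.
Qed.

Lemma jdens_ge0 k x : 0 <= jdens a b k x.
Proof.
apply: mulr_ge0; apply: prodr_ge0 => i _.
  by apply: prodr_ge0 => j ij; rewrite powR_ge0.
by apply: mulr_ge0; apply: powR_ge0.
Qed.

(** The tangent bounds multiply to an exponential whose part proportional to [k] is [critical_sum],
    up to the gaps. The bound [1 <= k * b] keeps the exponents of [1 - x_i] and [1 + x_i]
    nonnegative. *)
Lemma jdens_upper k x : 0 <= k -> 1 <= k * b -> alcove N x ->
  jdens a b k x <= jdens a b k z *
    expR (N%:R - (k * b / 2 - 2^-1) * \sum_(i < N) gap x i).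
Proof.
move=> k0 kb [x1 xinc].
have ka : 0 <= k * a by rewrite mulr_ge0.
have kq0 : 0 <= k * b / 2 - 2^-1 by lra.
have kp0 : 0 <= k * (a + b) / 2 - 2^-1 by rewrite mulrDr; lra.
pose P1 := \prod_(i < N) \prod_(j < N | (i < j)%N)
  ((z ord0 j - z ord0 i) `^ k *
    expR (k * ((x ord0 j - x ord0 i) / (z ord0 j - z ord0 i) - 1))).
pose P2 := \prod_(i < N)
  ((((1 - z ord0 i) `^ (k * (a + b) / 2 - 2^-1)) *
   expR ((k * (a + b) / 2 - 2^-1) * ((1 - x ord0 i) / (1 - z ord0 i) - 1))) *
  (((1 + z ord0 i) `^ (k * b / 2 - 2^-1)) *
   expR ((k * b / 2 - 2^-1) * ((1 + x ord0 i) / (1 + z ord0 i) - 1 - gap x i)))).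
have le12 : jdens a b k x <= P1 * P2.
  apply: ler_pM.
  - by apply: prodr_ge0 => i _; apply: prodr_ge0 => j _; rewrite powR_ge0.
  - by apply: prodr_ge0 => i _; rewrite mulr_ge0 ?powR_ge0.
  - apply: ler_prod => i _; rewrite prodr_ge0 => [|j _]; last exact: powR_ge0.
    apply: ler_prod => j ij; rewrite powR_ge0 /= powR_le_tangent //.
      by rewrite subr_ge0 xinc // ltnW.
    by rewrite subr_gt0 z_incr.
  - apply: ler_prod => i _.
    have /andP[z1 z2] := z_itv i; have /andP[y1 y2] := x1 i.
    rewrite mulr_ge0 ?powR_ge0 //=; apply: ler_pM; rewrite ?powR_ge0 //.
      by apply: powR_le_tangent => //; lra.
    by apply: powR_le_tangent_gap => //; lra.
apply: (le_trans le12); rewrite /P1 /P2.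
under eq_bigr => i _ do rewrite big_split /= -expR_sum.
rewrite big_split /= -expR_sum.
under [X in _ * X <= _]eq_bigr => i _ do rewrite mulrACA -expRD.
rewrite big_split /= -expR_sum mulrACA -expRD.
rewrite ler_wpM2l ?jdens_ge0 // ler_expR.
(* The fixed powers [- 2^-1] leave the remainder [1 - e i] per coordinate; since [e i >= 0], these
   add up to at most [N]. *)
pose e i := ((1 - x ord0 i) / (1 - z ord0 i) + (1 + x ord0 i) / (1 + z ord0 i)) / 2.
have := critical_sum x; set C := (X in X = 0) => hC.
rewrite [leLHS](_ : _ = k * C + \sum_(i < N) (1 - e i)
    - (k * b / 2 - 2^-1) * \sum_(i < N) gap x i); last first.
  rewrite /C [X in _ = X + _ + _]mulrDr !mulr_sumr -!addrA; congr (_ + _).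
    by apply: eq_bigr => i _; rewrite mulr_sumr.
  rewrite -sumrN -!big_split /=; apply: eq_bigr => i _.
  rewrite /e; move: (gap x i) ((1 - x ord0 i) / (1 - z ord0 i))
    ((1 + x ord0 i) / (1 + z ord0 i)) => g A B; by field.
rewrite hC mulr0 add0r lerD2r.
have -> : N%:R = \sum_(i < N) (1 : R) by rewrite sumr_const card_ord.
apply: ler_sum => i _; rewrite gerBl /e.
have /andP[z1 z2] := z_itv i; have /andP[y1 y2] := x1 i.
by apply: divr_ge0 => //; apply: addr_ge0; apply: divr_ge0; lra.
Qed.

(** Total exponent per unit of [k]: shrinking every factor by [expR (- eta)] costs at most
    [expR (- (k * (eta * T)))]. *)
Let T : R := \sum_(i < N) \sum_(j < N | (i < j)%N) 1 + \sum_(i < N) ((a + b) / 2 + b / 2).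

Lemma jdens_lower k x (m eta d : R) : 0 <= k -> 1 <= k * b -> 0 < m -> 0 < eta ->
  (forall i j : 'I_N, (i < j)%N -> m <= z ord0 j - z ord0 i) ->
  (forall i, m <= 1 - z ord0 i) -> (forall i, m <= 1 + z ord0 i) ->
  2 * d <= (1 - expR (- eta)) * m ->
  (forall i, z ord0 i - d <= x ord0 i <= z ord0 i + d) ->
  alcove N x /\ jdens a b k z * expR (- (k * (eta * T))) <= jdens a b k x.
Proof.
move=> k0 kb m0 eta0 m1 m2 m3 hd hx.
have rho0 : 0 < expR (- eta) by exact: expR_gt0.
have rho1 : expR (- eta) < 1 by rewrite expR_lt1 oppr_lt0.
set rho := expR (- eta) in hd rho0 rho1 *.
(* On the cube a factor changes by at most [2 * d], a difference of two coordinates being the worst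
   case; this is at most the fraction [1 - rho] of any [w >= m]. *)
have key w y : m <= w -> w - 2 * d <= y -> w * rho <= y.
  move=> mw wy; apply: (le_trans _ wy).
  have : (1 - rho) * m <= (1 - rho) * w by rewrite ler_wpM2l // subr_ge0 ltW.
  by move: hd; rewrite !mulrBl !mul1r; lra.
have pij (i j : 'I_N) : (i < j)%N ->
   (z ord0 j - z ord0 i) * rho <= x ord0 j - x ord0 i.
  move=> ij; apply: key; first exact: m1.
  have /andP[? ?] := hx i; have /andP[? ?] := hx j; lra.
have pm i : (1 - z ord0 i) * rho <= 1 - x ord0 i.
  by apply: key; rewrite ?m2 //; have /andP[? ?] := hx i; lra.
have pp i : (1 + z ord0 i) * rho <= 1 + x ord0 i.
  by apply: key; rewrite ?m3 //; have /andP[? ?] := hx i; lra.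
have ka : 0 <= k * a by rewrite mulr_ge0.
have kq0 : 0 <= k * b / 2 - 2^-1 by lra.
have kp0 : 0 <= k * (a + b) / 2 - 2^-1 by rewrite mulrDr; lra.
have zm i : 0 < 1 - z ord0 i by have /andP[? ?] := z_itv i; lra.
have zp i : 0 < 1 + z ord0 i by have /andP[? ?] := z_itv i; lra.
split.
  split=> [i|i j].
    have h1 := le_trans (ltW (mulr_gt0 (zm i) rho0)) (pm i).
    have h2 := le_trans (ltW (mulr_gt0 (zp i) rho0)) (pp i).
    by apply/andP; split; lra.
  rewrite leq_eqVlt => /orP[/eqP/val_inj -> //|ij].
  rewrite -subr_ge0; apply: le_trans (pij i j ij).
  by apply: mulr_ge0; [rewrite subr_ge0 ltW // z_incr | exact: ltW].
pose P1 := \prod_(i < N) \prod_(j < N | (i < j)%N)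
  ((z ord0 j - z ord0 i) `^ k * expR (k * - eta)).
pose P2 := \prod_(i < N)
  ((((1 - z ord0 i) `^ (k * (a + b) / 2 - 2^-1)) *
   expR ((k * (a + b) / 2 - 2^-1) * - eta)) *
  (((1 + z ord0 i) `^ (k * b / 2 - 2^-1)) *
   expR ((k * b / 2 - 2^-1) * - eta))).
have le12 : P1 * P2 <= jdens a b k x.
  apply: ler_pM.
  - by apply: prodr_ge0 => i _; apply: prodr_ge0 => j _; rewrite mulr_ge0 ?powR_ge0 ?expR_ge0.
  - by apply: prodr_ge0 => i _; rewrite !mulr_ge0 ?powR_ge0 ?expR_ge0.
  - apply: ler_prod => i _; rewrite prodr_ge0 => [|j _]; last by rewrite mulr_ge0 ?powR_ge0 ?expR_ge0.
    apply: ler_prod => j ij; rewrite mulr_ge0 ?powR_ge0 ?expR_ge0 //=.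
    by apply: powR_ge_scale; rewrite ?subr_gt0 ?z_incr ?pij.
  - apply: ler_prod => i _.
    rewrite !mulr_ge0 ?powR_ge0 ?expR_ge0 //=.
    by apply: ler_pM; rewrite ?mulr_ge0 ?powR_ge0 ?expR_ge0 //;
      apply: powR_ge_scale; rewrite ?zm ?zp ?pm ?pp.
apply: le_trans le12; rewrite /P1 /P2.
under [X in _ <= X * _]eq_bigr => i _ do rewrite big_split /= -expR_sum.
rewrite [X in _ <= X * _]big_split /= -expR_sum.
under [X in _ <= _ * X]eq_bigr => i _ do rewrite mulrACA -expRD.
rewrite [X in _ <= _ * X]big_split /= -expR_sum mulrACA -expRD.
rewrite ler_wpM2l ?jdens_ge0 // ler_expR.
rewrite /T !mulrDr opprD; apply: lerD.
  rewrite !mulr_sumr -sumrN; apply: ler_sum => i _.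
  by rewrite !mulr_sumr -sumrN; apply: ler_sum => j _; rewrite mulr1 mulrN.
rewrite !mulr_sumr -sumrN; apply: ler_sum => i _; lra.
Qed.

(** A single coordinate attaining the maximum norm suffices. As [m <= 1 + z_i <= 2], its ratio
    [(1 + x_i) / (1 + z_i)] is at most [2 / m] and differs from [1] by at least [eps / 2];
    [sqrt_gap] applies. *)
Lemma gap_sum_ge x (m eps : R) : 0 < eps -> 0 < m ->
  (forall i, m <= 1 + z ord0 i) -> alcove N x -> eps <= `|x - z| ->
  (eps / 2 / (2 / m + 2)) ^+ 2 <= \sum_(i < N) gap x i.
Proof.
move=> e0 m0 m3 [x1 _] exz.
have : mx_norm (x - z) != 0.
  by apply: lt0r_neq0; apply: lt_le_trans exz.
move=> /mx_norm_neq0[[i0 i] /= hi].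
have ei : eps <= `|x ord0 i - z ord0 i|.
  by move: exz; rewrite /Num.norm /= hi !mxE (ord1 i0).
rewrite (bigD1 i) //=; apply: ler_wpDr.
  by apply: sumr_ge0 => j _; apply: sqr_ge0.
have /andP[z1 z2] := z_itv i; have /andP[y1 y2] := x1 i.
have zp : 0 < 1 + z ord0 i by lra.
apply: sqrt_gap; first by rewrite divr_gt0.
- by rewrite addr_gt0 // divr_gt0.
- by apply: divr_ge0; lra.
- rewrite lerD2r; apply: ler_pM; [lra | by rewrite invr_ge0 ltW | lra |].
  by rewrite lef_pV2 ?posrE.
have -> : (1 + x ord0 i) / (1 + z ord0 i) - 1 = (x ord0 i - z ord0 i) / (1 + z ord0 i).
  by field; rewrite gt_eqF.
rewrite normrM normfV (ger0_norm (ltW zp)).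
apply: ler_pM; [exact: ltW | by rewrite invr_ge0 | by [] |].
by rewrite lef_pV2 ?posrE //; lra.
Qed.
End Density.

(** * Bounding integrals above and below by boxes *)

Section BoxIndicator.
Variables (R : realType) (N : nat) (l r : 'I_N -> R).

Lemma prod_indic_ge0 (x : 'rV[R]_N) :
  0 <= \prod_i (\1_`[l i, r i] (x ord0 i) : R).
Proof. by apply: prodr_ge0 => i _; rewrite indicE. Qed.

Lemma prod_indic_in (x : 'rV[R]_N) : (forall i, l i <= x ord0 i <= r i) ->
  \prod_i (\1_`[l i, r i] (x ord0 i) : R) = 1.
Proof. by move=> h; apply: big1 => i _; rewrite indicE mem_set //= in_itv /= h. Qed.

Lemma prod_indic_notin (x : 'rV[R]_N) : ~ (forall i, l i <= x ord0 i <= r i) ->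
  \prod_i (\1_`[l i, r i] (x ord0 i) : R) = 0.
Proof.
by move=> /existsNP[i hi]; rewrite (bigD1 i) //= indicE memNset ?mul0r //=.
Qed.
End BoxIndicator.

Section IntegralBounds.
Variables (R : realType) (N : nat) (f : 'rV[R]_N -> R).
Hypothesis f0 : forall x, 0 <= f x.

Let I (A : set 'rV[R]_N) := iint (fun x => (\1_A x * f x)%:E).

Lemma iint_indic_ge0 A : (0 <= I A)%E.
Proof. by apply: iint_ge0 => x; rewrite lee_fin mulr_ge0. Qed.

(** The alcove lies in the cube with sides [[-1, 1]], of volume [2 ^+ N]. *)
Lemma iint_alcove_le (A : set 'rV[R]_N) (M : R) :
  A `<=` alcove N -> 0 <= M -> (forall x, A x -> f x <= M) ->
  (I A <= (M * 2 ^+ N)%:E)%E.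
Proof.
move=> AN M0 fM; pose l (i : 'I_N) : R := -1; pose r (i : 'I_N) : R := 1.
have -> : 2 ^+ N = \prod_i (r i - l i).
  rewrite (eq_bigr (fun=> 2)) ?prodr_const ?card_ord // => i _.
  by rewrite /r /l opprK.
rewrite -iint_box // => [|i]; last by rewrite /l /r; lra.
apply: le_iint => x; rewrite lee_fin; first by rewrite mulr_ge0.
rewrite indicE; have [/set_mem xA|_] := boolP (x \in A); last first.
  by rewrite mul0r mulr_ge0 // prod_indic_ge0.
by rewrite prod_indic_in ?mul1r ?mulr1 ?fM //; have [] := AN _ xA.
Qed.

Lemma iint_box_le (A : set 'rV[R]_N) (z : 'rV[R]_N) (d M : R) :
  0 <= M -> 0 <= d ->
  (forall x : 'rV[R]_N, (forall i, z ord0 i - d <= x ord0 i <= z ord0 i + d) ->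
     A x /\ M <= f x) ->
  ((M * (2 * d) ^+ N)%:E <= I A)%E.
Proof.
move=> M0 d0 hM.
pose l (i : 'I_N) : R := z ord0 i - d; pose r (i : 'I_N) : R := z ord0 i + d.
have -> : (2 * d) ^+ N = \prod_i (r i - l i).
  rewrite (eq_bigr (fun=> 2 * d)) ?prodr_const ?card_ord // => i _.
  by rewrite /r /l; ring.
rewrite -iint_box // => [|i]; last by rewrite /l /r; lra.
apply: le_iint => x; rewrite lee_fin; first by rewrite mulr_ge0 // prod_indic_ge0.
have [h|h] := pselect (forall i, l i <= x ord0 i <= r i).
  have [Ax fx] := hM x h.
  by rewrite prod_indic_in // indicE mem_set // mul1r mulr1.
by rewrite prod_indic_notin // mulr0 mulr_ge0.
Qed.
End IntegralBounds.

(** * Exponential decay and convergence in probability *)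

Lemma cvg_expR_decay (R : realType) (C theta k0 : R) (f : R -> R) :
  0 < theta -> (forall k, k0 < k -> 0 <= f k <= C * expR (- (theta * k))) ->
  f @ +oo --> (0 : R).
Proof.
move=> th0 hf; have C0 : 0 <= C.
  have /andP[h1 h2] := hf (k0 + 1) ltac:(lra).
  have := le_trans h1 h2; rewrite pmulr_lge0 //; exact: expR_gt0.
apply/cvgrPdist_lt => e e0; near=> k.
have /andP[h1 h2] : 0 <= f k <= C * expR (- (theta * k)).
  by apply: hf; near: k; apply: nbhs_pinfty_gt; rewrite num_real.
rewrite sub0r normrN ger0_norm //; apply: (le_lt_trans h2).
rewrite expRN ltr_pdivrMr ?expR_gt0 //.
(* Beyond this threshold [expR (theta * k) >= 1 + theta * k] exceeds [C / e]. *)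
have hk : C / e / theta < k.
  by near: k; apply: nbhs_pinfty_gt; rewrite num_real.
rewrite mulrC -ltr_pdivrMr //.
apply: (@lt_le_trans _ _ (1 + theta * k)); last exact: expR_ge1Dx.
by move: hk; rewrite ltr_pdivrMr // (mulrC k); lra.
Unshelve. all: by end_near.
Qed.

Theorem theorem2p3 (R : realType) (N : nat) (a b : R) (z : 'rV[R]_N) :
  0 <= a -> 0 < b ->
  (forall i j : 'I_N, (i < j)%N -> z ord0 i < z ord0 j) ->
  (forall i : 'I_N, root (jacobiP N (a + b - 1) (b - 1)) (z ord0 i)) ->
  forall eps : R, 0 < eps ->
    (fun k : R => jmu N a b k [set x | eps <= `|x - z|]) @ +oo --> (0 : R).
Proof.
move=> a0 b0 z_incr z_root eps eps0.
have al1 : -1 < a + b - 1 by lra.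
have be1 : -1 < b - 1 by lra.
have z_itv i : -1 < z ord0 i < 1.
  exact: jacobiP_root_itv al1 be1 (z_root i).
have z_inj : injective (fun i => z ord0 i).
  move=> i j /= h; apply: val_inj; case: (ltngtP i j) => // /z_incr;
  by rewrite h ltxx.
have z_crit i : 2 * (\sum_(j < N | j != i) (z ord0 i - z ord0 j)^-1)
    - (a + b) / (1 - z ord0 i) + b / (1 + z ord0 i) = 0.
  have := jacobi_critical R N _ _ (fun i => z ord0 i) al1 be1 z_inj z_root i.
  by rewrite !subrK.
have [m1 m1_0 hm1] : exists2 m, 0 < m &
    forall ij : 'I_N * 'I_N, (ij.1 < ij.2)%N -> m <= z ord0 ij.2 - z ord0 ij.1.
  by apply: exists_pos_lbound => ij h; rewrite subr_gt0 z_incr.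
have [m2 m2_0 hm2] : exists2 m, 0 < m & forall i, true -> m <= 1 - z ord0 i.
  by apply: (@exists_pos_lbound _ _ xpredT) => i _; have /andP[? ?] := z_itv i; lra.
have [m3 m3_0 hm3] : exists2 m, 0 < m & forall i, true -> m <= 1 + z ord0 i.
  by apply: (@exists_pos_lbound _ _ xpredT) => i _; have /andP[? ?] := z_itv i; lra.
pose m := Num.min m1 (Num.min m2 m3).
have m0 : 0 < m by rewrite !lt_min m1_0 m2_0 m3_0.
have mm1 (i j : 'I_N) : (i < j)%N -> m <= z ord0 j - z ord0 i.
  by move=> ij; rewrite ge_min (hm1 (i, j)).
have mm2 i : m <= 1 - z ord0 i by rewrite !ge_min hm2 ?orbT.
have mm3 i : m <= 1 + z ord0 i by rewrite !ge_min hm3 ?orbT.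
(* The total gap guaranteed by [gap_sum_ge] at distance [eps] from [z]. *)
pose c := (eps / 2 / (2 / m + 2)) ^+ 2.
have c0 : 0 < c.
  by rewrite exprn_gt0 // !divr_gt0 // addr_gt0 // divr_gt0.
pose T := \sum_(i < N) \sum_(j < N | (i < j)%N) 1
          + \sum_(i < N) ((a + b) / 2 + b / 2).
have T0 : 0 <= T.
  apply: addr_ge0; apply: sumr_ge0 => i _; last by lra.
  by apply: sumr_ge0.
(* [eta] is so small that the loss [eta * T] on a cube around [z] is at most
   half of the gain [b / 2 * c] away from [z]. *)
pose eta := b * c / (4 * (T + 1)).
have T1 : 0 < T + 1 by lra.
have eta0 : 0 < eta by apply: divr_gt0; apply: mulr_gt0.
have etaT : eta * T <= b * c / 4.
  have -> : b * c / 4 = eta * (T + 1) by rewrite /eta; field; rewrite gt_eqF.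
  by rewrite ler_pM2l //; lra.
pose d := (1 - expR (- eta)) * m / 2.
have d0 : 0 < d.
  apply: divr_gt0 => //; apply: mulr_gt0 => //.
  by rewrite subr_gt0 expR_lt1 oppr_lt0.
have hd : 2 * d <= (1 - expR (- eta)) * m by rewrite /d mulrC divfK.
(* The factor independent of [k] in the quotient of the numerator bound by the denominator bound;
   [c / 2] comes from the [- 2^-1] in the exponent of [1 + x_i]. The rate [b * c / 4] is the gain
   [b * c / 2] less the loss [eta * T], and [k > b^-1] yields [1 <= k * b]. *)
pose C := expR (N%:R + c / 2) * 2 ^+ N / (2 * d) ^+ N.
apply: (@cvg_expR_decay _ C (b * c / 4) b^-1) => [|k kb'].
  by rewrite divr_gt0 // mulr_gt0.
have k0 : 0 <= k by apply/ltW/(lt_trans _ kb'); rewrite invr_gt0.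
have kb : 1 <= k * b by rewrite -ler_pdivrMr // div1r ltW.
set S := [set x | _].
pose K := jdens a b k z.
have K0 : 0 < K by exact: jdens_gt0.
have f0 := @jdens_ge0 R N a b k.
have q0 : 0 <= k * b / 2 - 2^-1 by lra.
have up x : alcove N x -> jdens a b k x <= K * expR N%:R.
  move=> Ax; apply: (le_trans (jdens_upper _ _ _ _ _ a0 z_incr z_itv z_crit k x k0 kb Ax)).
  rewrite ler_pM2l // ler_expR gerBl mulr_ge0 //.
  by apply: sumr_ge0 => i _; exact: sqr_ge0.
have upS x : (alcove N `&` S) x ->
    jdens a b k x <= K * expR (N%:R - (k * b / 2 - 2^-1) * c).
  move=> [Ax Sx]; apply: (le_trans (jdens_upper _ _ _ _ _ a0 z_incr z_itv z_crit k x k0 kb Ax)).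
  rewrite ler_pM2l // ler_expR lerD2l lerN2 ler_wpM2l //.
  exact: gap_sum_ge.
have low (x : 'rV[R]_N) : (forall i, z ord0 i - d <= x ord0 i <= z ord0 i + d) ->
    alcove N x /\ K * expR (- (k * (eta * T))) <= jdens a b k x.
  exact: (jdens_lower _ _ _ _ _ a0 z_incr z_itv k x m eta d).
rewrite /jmu; set num := iint _; set den := iint _.
have num0 : (0 <= num)%E by exact: iint_indic_ge0.
have num_le : (num <= (K * expR (N%:R - (k * b / 2 - 2^-1) * c) * 2 ^+ N)%:E)%E.
  apply: iint_alcove_le => //.
  by rewrite mulr_ge0 ?expR_ge0 // ltW.
have den_le : (den <= (K * expR N%:R * 2 ^+ N)%:E)%E.
  by apply: iint_alcove_le => //; rewrite mulr_ge0 ?expR_ge0 // ltW.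
have den_ge : ((K * expR (- (k * (eta * T))) * (2 * d) ^+ N)%:E <= den)%E.
  apply: iint_box_le low => //; last exact: ltW.
  by rewrite mulr_ge0 ?expR_ge0 // ltW.
(* Both integrals lie between finite bounds, so [fine] returns their true values. *)
case: num num0 num_le => [num| |] //=; rewrite ?lee_fin => num0 num_le.
case: den den_le den_ge => [den| |] //=; rewrite ?lee_fin => _ den_ge.
have D0 : 0 < K * expR (- (k * (eta * T))) * (2 * d) ^+ N.
  apply: mulr_gt0; first by rewrite mulr_gt0 ?expR_gt0.
  by rewrite exprn_gt0 // mulr_gt0.
have den0 : 0 < den := lt_le_trans D0 den_ge.
rewrite divr_ge0 ?(ltW den0) //= ler_pdivrMr //.
apply: (le_trans num_le).
apply: (@le_trans _ _ (C * expR (- (b * c / 4 * k)) *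
   (K * expR (- (k * (eta * T))) * (2 * d) ^+ N))); last first.
  rewrite ler_pM2l //; apply: mulr_gt0; last exact: expR_gt0.
  apply: divr_gt0; first by apply: mulr_gt0; rewrite ?expR_gt0 ?exprn_gt0.
  by rewrite exprn_gt0 // mulr_gt0.
have dN : (2 * d) ^+ N != 0 by rewrite expf_neq0 // gt_eqF // mulr_gt0.
(* The cube volume cancels against [C]; comparing exponents leaves exactly [etaT] multiplied by
   [k]. *)
rewrite [leRHS](_ : _ = K * expR (N%:R + c / 2 - b * c / 4 * k - k * (eta * T)) * 2 ^+ N).
  rewrite ler_pM2r ?exprn_gt0 // ler_pM2l // ler_expR.
  have : k * (eta * T) <= k * (b * c / 4) by rewrite ler_wpM2l.
  by lra.
by rewrite /C !expRD; field.
Qed.
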